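(* For even $b\ge2$: $K_{2+2\lambda}(2)=b^2+1+2\lambda$ for $0\le\lambda\le b-2$. For odd $b\ge3$: $K_{2+2\lambda}(2)=b+1+2\lambda$ for $0\le\lambda\le\frac{b-3}{2}$.
   Context: Fix a base $b\ge2$. For $v\in\mathbb{N}$, $s(v)$ is the sum of the base-$b$ digits of $v$, $f(v)=v+s(v)$, and $F(u)=|\{v\in\mathbb{N}: f(v)=u\}|$. For a residue class $i$ modulo $b-1$ (with $i$ even if $b$ is odd), $K_i(n)$ is the smallest $u\in\mathbb{N}$ with $F(u)=n$ and $u\equiv i\pmod{b-1}$. Subscripts are read modulo $b-1$. *)

(* Defs.v *)
From mathcomp Require Import all_boot.

Set Implicit Arguments.
Unset Strict Implicit.
Unset Printing Implicit Defensive.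

(* The digit of b ^ k in v is (v %/ b ^ k) %% b.  For 2 <= b the digits with
   v <= k vanish, because v < b ^ v; see digit_eq0. *)
Definition digit (b v k : nat) : nat := (v %/ b ^ k) %% b.

Definition digit_sum (b v : nat) : nat := \sum_(k < v) digit b v k.

Lemma digit_eq0 (b v k : nat) : 2 <= b -> v <= k -> digit b v k = 0.
Proof.
move=> hb hvk; rewrite /digit divn_small ?mod0n //.
by apply: leq_ltn_trans hvk _; exact: ltn_expl.
Qed.

Definition f (b v : nat) : nat := v + digit_sum b v.

Lemma leq_f (b v : nat) : v <= f b v.
Proof. exact: leq_addr. Qed.

(* By leq_f all preimages of u under f are at most u, so this is the number of
   all natural v with f v = u. *)
Definition F (b u : nat) : nat := #|[set v : 'I_u.+1 | f b v == u]|.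

(* is_K b i n u says that K_i(n) exists and equals u; the index i only matters
   modulo b - 1. *)
Definition is_K (b i n u : nat) : Prop :=
  [/\ F b u = n,
      u = i %[mod b - 1] &
      forall u' : nat, F b u' = n -> u' = i %[mod b - 1] -> u <= u'].

(* Main.v *)
Require Import Defs.
From mathcomp Require Import all_boot.
From mathcomp Require Import zify.

Set Implicit Arguments.
Unset Strict Implicit.
Unset Printing Implicit Defensive.

(** On numbers below [b ^ 2] the map [f] is [d * b + c |-> d * (b + 1) + 2 * c].
    For odd [b] the first collisions are those of the one-digit numbers with the
    numbers [b + l].  For even [b] the map is injective below [b ^ 2]: a collision
    would force the leading digits to differ by exactly one, against parity.
    So every collision involves some [b ^ 2 + w], where
    [f (b ^ 2 + w) = b ^ 2 + 1 + f w].  Stepping back by [b - 1] from the claimed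
    minimum [u] leaves the range of collisions when [b] is odd; when [b] is even
    the one candidate possibly still in that range, [u - (b - 1)], has the wrong
    parity. *)

(** The definition ties the number of summands to [v]; a free bound lets the digit sums of [v] and
    [v %/ b] be compared term by term. *)
Lemma digit_sum_widen (b v n : nat) : 2 <= b -> v <= n ->
  digit_sum b v = \sum_(k < n) digit b v k.
Proof.
move=> hb hvn; rewrite /digit_sum -!(big_mkord xpredT (digit b v)).
rewrite [RHS](big_cat_nat (leq0n v) hvn) //= [X in _ = _ + X]big_nat.
by rewrite [X in _ = _ + X]big1 ?addn0 // => k /andP[hvk _]; exact: digit_eq0.
Qed.

Lemma digit_sum_rec (b v : nat) : 2 <= b ->
  digit_sum b v = v %% b + digit_sum b (v %/ b).
Proof.
move=> hb; rewrite (digit_sum_widen hb (leqnSn v)) big_ord_recl.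
rewrite (digit_sum_widen hb (leq_div v b)) /digit expn0 divn1; congr addn.
by apply: eq_bigr => k _; rewrite /= /bump /= add1n expnS divnMA.
Qed.

Lemma digit_sum_small (b v : nat) : 2 <= b -> v < b -> digit_sum b v = v.
Proof.
move=> hb hv; rewrite digit_sum_rec // modn_small // divn_small //.
by rewrite /digit_sum big_ord0 addn0.
Qed.

Lemma f_small (b v : nat) : 2 <= b -> v < b -> f b v = 2 * v.
Proof. by move=> hb hv; rewrite /f digit_sum_small // addnn mul2n. Qed.

Lemma f_two_digits (b d c : nat) : 2 <= b -> d < b -> c < b ->
  f b (d * b + c) = d * (b + 1) + 2 * c.
Proof.
move=> hb hd hc; rewrite /f digit_sum_rec // modnMDl modn_small //.
rewrite divnMDl; last lia.
rewrite divn_small // addn0 digit_sum_small //; lia.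
Qed.

Lemma two_digitsP (b v : nat) : v < b ^ 2 ->
  exists d c, [/\ d < b, c < b & v = d * b + c].
Proof.
move=> hv; have hb : 0 < b by case: b hv.
exists (v %/ b), (v %% b); split; last exact: divn_eq.
  by rewrite ltn_divLR // mulnn.
by rewrite ltn_mod.
Qed.

(** As [w] has at most two digits, adding [b ^ 2] only puts a digit 1 in front of them. *)
Lemma f_add_sqr (b w : nat) : 2 <= b -> w < b ^ 2 ->
  f b (b ^ 2 + w) = b ^ 2 + 1 + f b w.
Proof.
move=> hb /two_digitsP[d [c [hd hc ->]]]; rewrite f_two_digits //.
have -> : b ^ 2 + (d * b + c) = (1 * b + d) * b + c by rewrite -mulnn; lia.
have hb0 : 0 < b by lia.
rewrite /f digit_sum_rec // modnMDl modn_small // divnMDl // (divn_small hc) addn0.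
rewrite digit_sum_rec // modnMDl modn_small // divnMDl // (divn_small hd) addn0.
rewrite digit_sum_small // -mulnn; lia.
Qed.

Lemma f_inj_even (b v w : nat) : 2 <= b -> ~~ odd b -> v < b ^ 2 -> w < b ^ 2 ->
  f b v = f b w -> v = w.
Proof.
move=> hb ob /two_digitsP[d [c [hd hc ->]]] /two_digitsP[d' [c' [hd' hc' ->]]].
rewrite !f_two_digits // => e.
have od : odd d = odd d'.
  by move: (congr1 odd e); rewrite !(oddD, oddM) (negbTE ob) !andbT /= !addbF.
(* A gap of [2 * (b + 1)] cannot be made up by the units digit, which contributes at most
   [2 * (b - 1)]. *)
have ne x y k k' : k' < b -> x * (b + 1) + 2 * k = y * (b + 1) + 2 * k' ->
    ~ (y + 2 <= x).
  by move=> hk' e' hxy; have := leq_mul hxy (leqnn (b + 1)); lia.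
have := ne _ _ _ _ hc' e; have := ne _ _ _ _ hc (esym e) => h1 h2.
have ed : d = d' by lia.
by subst d'; lia.
Qed.

Lemma F_le1 (b u : nat) :
  (forall v w, f b v = u -> f b w = u -> v = w) -> F b u <= 1.
Proof.
move=> h; apply/card_le1_eqP => x y; rewrite !inE => /eqP hx /eqP hy.
by apply: val_inj; apply: h.
Qed.

Lemma F_eq2 (b u v w : nat) : v != w -> f b v = u -> f b w = u ->
  (forall x, f b x = u -> x = v \/ x = w) -> F b u = 2.
Proof.
move=> vw hv hw h.
have lu x : f b x = u -> x < u.+1 by move=> <-; rewrite ltnS leq_f.
rewrite /F; have -> : [set x : 'I_u.+1 | f b x == u]
    = [set Ordinal (lu v hv); Ordinal (lu w hw)].
  apply/setP => x; rewrite !inE -!val_eqE /=; apply/eqP/orP.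
    by move=> /h [] ->; rewrite eqxx; [left | right].
  by case=> /eqP ->.
by rewrite cards2 -val_eqE /= vw.
Qed.

Lemma eqmod_lt_add (m x y : nat) : x = y %[mod m] -> x < y -> x + m <= y.
Proof.
move=> /esym/eqP; move=> e xy; move: e; rewrite eqn_mod_dvd ?(ltnW xy) // => dv.
by have := dvdn_leq _ dv; rewrite subn_gt0 => /(_ xy); lia.
Qed.

Lemma is_K_even (b l : nat) : 2 <= b -> ~~ odd b -> l <= b - 2 ->
  is_K b (2 + 2 * l) 2 (b ^ 2 + 1 + 2 * l).
Proof.
move=> hb ob hl.
have hbb : 2 * b <= b ^ 2 by rewrite -mulnn leq_mul2r hb orbT.
have sq : b ^ 2 = (b - 1) * b + b by rewrite -mulnn -{1}(subnK (ltnW hb)) mulnDl mul1n.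
have hlb : l < b by lia.
have v1lt : (b - 1) * b + (l + 1) < b ^ 2 by lia.
have fv1 : f b ((b - 1) * b + (l + 1)) = b ^ 2 + 1 + 2 * l.
  by rewrite f_two_digits //; lia.
have fv2 : f b (b ^ 2 + l) = b ^ 2 + 1 + 2 * l.
  by rewrite f_add_sqr ?f_small //; lia.
(* Here [x <= f b x], and [1 + 2 * l < 2 * b <= b ^ 2] bounds the remainder [w]. *)
have above x : b ^ 2 <= x -> f b x <= b ^ 2 + 1 + 2 * l ->
    exists2 w, x = b ^ 2 + w & w < b ^ 2 /\ f b x = b ^ 2 + 1 + f b w.
  move=> hx hfx; have lfx := leq_f b x.
  have hw : x - b ^ 2 < b ^ 2 by lia.
  exists (x - b ^ 2); first lia.
  by split=> //; rewrite -f_add_sqr // subnKC.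
have res : b ^ 2 + 1 + 2 * l = 2 + 2 * l %[mod b - 1].
  have -> : b ^ 2 + 1 + 2 * l = (b + 1) * (b - 1) + (2 + 2 * l) by lia.
  by rewrite modnMDl.
split=> //.
- apply: (F_eq2 _ fv1 fv2); first by apply/eqP; lia.
  move=> x hx; have [xl | xg] := ltnP x (b ^ 2).
    by left; apply: (f_inj_even hb ob) => //; rewrite hx.
  have [|w xw [hw fx]] := above x xg; first by rewrite hx.
  right; rewrite xw; congr addn; apply: (f_inj_even hb ob) => //; first lia.
  by rewrite (f_small hb hlb); lia.
- move=> u Fu /[dup] ru; rewrite -res => ru'; rewrite leqNgt; apply/negP => ult.
  have := eqmod_lt_add ru' ult => ule.
  suff below x : f b x = u -> x < b ^ 2.
    have : F b u <= 1 by apply: F_le1 => v w hv hw;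
      apply: (f_inj_even hb ob); rewrite ?hv ?hw //; apply: below.
    by rewrite Fu.
  move=> hx; rewrite ltnNge; apply/negP => xg.
  have [|w xw [hw fx]] := above x xg; first lia.
  (* [w <= f b w = u - b ^ 2 - 1], which is at most [2 * l - (b - 1) <= b - 3]. *)
  have wlt : w < b by have := leq_f b w; lia.
  move: fx; rewrite hx f_small // => ux.
  (* Since [l <= b - 2], two steps of [b - 1] down from the target already fall below [b ^ 2],
     whereas [u > b ^ 2]. So [u] is exactly one step down, and [ux] then yields
     [b - 1 = 2 * (l - w)], impossible for even [b]. *)
  have step : u + (b - 1) = b ^ 2 + 1 + 2 * l.
    have [ult2|] := ltnP (u + (b - 1)) (b ^ 2 + 1 + 2 * l); last lia.
    have ru2 : u + (b - 1) = b ^ 2 + 1 + 2 * l %[mod b - 1] by rewrite modnDr.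
    by have := eqmod_lt_add ru2 ult2; lia.
  lia.
Qed.

Lemma is_K_odd (b l : nat) : 3 <= b -> odd b -> l <= (b - 3) %/ 2 ->
  is_K b (2 + 2 * l) 2 (b + 1 + 2 * l).
Proof.
move=> hb3 ob hl; have hb : 2 <= b by lia.
(* All preimages of the target lie in this range, because [b + 1 + 2 * l <= 2 * b - 2]; both
   branches are linear, hence within reach of [lia]. *)
have two x : x < b \/ b <= x < 2 * b ->
    x < b /\ f b x = 2 * x \/ b <= x /\ f b x + b = 2 * x + 1.
  case=> [xb|/andP[xb x2]]; first by left; rewrite f_small.
  right; split=> //.
  have -> : x = 1 * b + (x - b) by lia.
  by rewrite f_two_digits //; lia.
have res : b + 1 + 2 * l = 2 + 2 * l %[mod b - 1].
  have -> : b + 1 + 2 * l = 1 * (b - 1) + (2 + 2 * l) by lia.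
  by rewrite modnMDl.
split=> //.
(* The first witness is half the target, an integer as [b] is odd; the second has digits 1 and
   [l]. *)
- apply: (@F_eq2 _ _ ((b + 1) %/ 2 + l) (b + l)); first by apply/eqP; lia.
  + by rewrite f_small //; lia.
  + by have := two (b + l); lia.
  + by move=> x hx; have := leq_f b x; have := two x; lia.
- move=> u Fu; rewrite -res => ru; rewrite leqNgt; apply/negP => ult.
  have ule := eqmod_lt_add ru ult.
  (* One step down gives [u <= 2 + 2 * l <= b - 1], so only one-digit preimages remain, where [f] is
     doubling. *)
  have ub : u < b by lia.
  have : F b u <= 1.
    have half x : f b x = u -> 2 * x = u.
      by move=> hx; rewrite -hx f_small // (leq_ltn_trans (leq_f b x)) // hx.
    by apply: F_le1 => v w /half hv /half hw; lia.
  by rewrite Fu.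
Qed.

Theorem theorem4p6 :
  (forall b : nat, 2 <= b -> ~~ odd b ->
     forall l : nat, l <= b - 2 ->
       is_K b (2 + 2 * l) 2 (b ^ 2 + 1 + 2 * l)) /\
  (forall b : nat, 3 <= b -> odd b ->
     forall l : nat, l <= (b - 3) %/ 2 ->
       is_K b (2 + 2 * l) 2 (b + 1 + 2 * l)).
Proof.
by split=> b hb ob l hl; [exact: is_K_even | exact: is_K_odd].
Qed.
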